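(* If $P_{1,2}^{[d]} \trianglelefteq_{\textup{aff}} P^{[e]}_{1,1}$, then $e \ge \exp(d)$, i.e. $e \ge 2^{\Omega(d)}$.
   Context: $P^{[d]}_{1,2} := x_1\cdots x_d + x_{d+1}^d + x_{d+2}^d$ (in $d+2$ variables) and $P^{[e]}_{1,1} := z_1\cdots z_e + z_{e+1}^e$ (in $e+1$ variables). For polynomials $f$ in variables $x\in\mathbb{C}^n$ and $g$ in variables $w\in\mathbb{C}^N$, $f\trianglelefteq_{\textup{aff}} g$ means $f$ lies in the closure (in the coefficient space) of $\{x\mapsto g(Ax+b) : A\in\mathbb{C}^{N\times n},\, b\in\mathbb{C}^N\}$. *)

(* Defs.v *)
From mathcomp Require Import all_boot all_order all_algebra.
From mathcomp Require Import complex mpoly.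
From mathcomp Require Import classical_sets reals topology normedtype exp.

Set Implicit Arguments.
Unset Strict Implicit.
Unset Printing Implicit Defensive.

Import Order.TTheory GRing.Theory Num.Theory.
Import numFieldNormedType.Exports.

Local Open Scope classical_set_scope.
Local Open Scope complex_scope.
Local Open Scope ring_scope.

(* P^{[d]}_{1,s}: the variables x_1, ..., x_d of the product are the indices
   [lshift s i], and x_{d+1}, ..., x_{d+s} are the indices [rshift d j]. *)
Definition prod_plus_powers (K : comNzRingType) (s d : nat) : {mpoly K[d + s]} :=
  \prod_(i < d) 'X_(lshift s i) + \sum_(j < s) 'X_(rshift d j) ^+ d.

(* x |-> g (A x + b) *)
Definition aff_subst (K : comNzRingType) (N n : nat) (g : {mpoly K[N]})
    (A : 'M[K]_(N, n)) (b : 'cV[K]_N) : {mpoly K[n]} :=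
  g \mPo [tuple \sum_(j < n) A i j *: 'X_j + (b i ord0)%:MP | i < N].

(* The coefficient space, with the topology of coefficientwise convergence.
   The polynomials of total degree at most D form a closed subspace, on which
   this is the usual topology of a finite-dimensional complex vector space.
   [R[i]^o] is the complex field with its norm topology. *)
Definition coeffs (R : realType) (n : nat) (p : {mpoly R[i][n]}) :
    {ptws 'X_{1..n} -> R[i]^o} :=
  fun m => p@_m.

(* Since deg g (Ax + b) <= deg g, the set below lies in one such subspace. *)
Definition aff_degeneration (R : realType) (n N : nat)
    (f : {mpoly R[i][n]}) (g : {mpoly R[i][N]}) : Prop :=
  closure [set coeffs (aff_subst g Ab.1 Ab.2)
            | Ab in [set: 'M[R[i]]_(N, n) * 'cV[R[i]]_N]]
    (coeffs f).

(* Main.v *)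
Require Import Defs.
From mathcomp Require Import all_boot all_order all_algebra.
From mathcomp Require Import complex mpoly.
From mathcomp Require Import classical_sets reals topology normedtype exp.
From mathcomp Require Import boolp filter ring lra zify.

Set Implicit Arguments.
Unset Strict Implicit.
Unset Printing Implicit Defensive.

Import Order.TTheory GRing.Theory Num.Theory.
Import numFieldNormedType.Exports.

Local Open Scope complex_scope.
Local Open Scope ring_scope.

(** Take an ultrafilter on the pairs (A, b) along which the coefficients of
    T1 + l^e tend to those of f = x_1 ... x_d + y^d + z^d, where T1 is a product
    of e affine forms and l is one affine form.  Along an ultrafilter every
    complex function converges or tends to infinity.

    If l converges, then so does T1, and f - l^e is a limit of products of
    affine forms; restricted to a suitable plane it is either s^d + t^d - 1
    (on l = 1, if l involves some x_i) or s t + C with C nonzero (otherwise).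
    A nonconstant limit of products of affine forms in two variables vanishes on
    a line, and neither curve contains one.

    If l diverges, there are a point p with l(p) -> oo and a convergent family
    of directions w, tangent to the level sets of l, along which
    f(p + tau w) has tau^(d-1)-coefficient proportional to w_1 ... w_(d-1).
    On these lines T1 = a prod_i (1 + tau lambda_i(w)) with a = T1(p) -> oo,
    and T1 - f tends to be constant, so Newton's identities, multiplied by a,
    linearize in the limit: a sum_i lambda_i(w)^(d-1) tends to a nonzero
    multiple of w_1 ... w_(d-1).  At the points w = 1_S + 1_T - 1, with S, T
    subsets of {1, ..., d-1}, the limit is an invertible diagonal matrix of size
    2^(d-1), while the approximating matrices have rank at most e d. *)

(** * Newton's identities and the rank of sums of powers *)

Section Algebra.

Lemma deriv_bigprod (R : comNzRingType) (I : finType) (P : I -> {poly R}) :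
  (\prod_i P i)^`() = \sum_i (P i)^`() * \prod_(j | j != i) P j.
Proof.
suff gen (r : seq I) : uniq r -> (\prod_(i <- r) P i)^`() =
    \sum_(i <- r) (P i)^`() * \prod_(j <- r | j != i) P j.
  by rewrite gen // index_enum_uniq.
elim: r => [|k r IHr] /=; first by rewrite !big_nil derivC.
case/andP=> knr /IHr {}IHr; rewrite !big_cons derivM IHr eqxx /=.
congr (_ * _ + _).
  rewrite big_seq [RHS]big_seq_cond; apply: eq_bigl => i.
  by case: eqP => [->|_]; rewrite ?andbT // (negbTE knr).
rewrite mulr_sumr !big_seq; apply: eq_bigr => i ir.
rewrite big_cons; case: eqP => [ki|_]; first by rewrite ki ir in knr.
by rewrite mulrCA.
Qed.

(** Logarithmic derivative: E' is the sum of the l_i S_i, where [S i] omits the i-th factor, and S_i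
    = E / (1 + l_i X) expands as a geometric series. *)
Lemma newton_identity (R : comNzRingType) (I : finType) (l : I -> R) (k : nat) :
  let E := \prod_i (1 + l i *: 'X) in
  E`_k.+1 *+ k.+1 =
  \sum_(j < k.+1) (-1) ^+ j * (\sum_i l i ^+ j.+1) * E`_(k - j).
Proof.
move=> E; pose S i := \prod_(j | j != i) (1 + l j *: 'X) : {poly R}.
have ES i : E = S i + l i *: (S i * 'X).
  by rewrite /E (bigD1 i) //= mulrDl mul1r -scalerAl [S i * 'X]mulrC.
have Sk i m : (S i)`_m = \sum_(j < m.+1) (- l i) ^+ j * E`_(m - j).
  elim: m => [|m IHm].
    by rewrite big_ord1 expr0 mul1r subnn (ES i) coefD coefZ coefMX mulr0 addr0.
  rewrite big_ord_recl expr0 mul1r subn0 {1}(ES i) coefD coefZ coefMX /=.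
  rewrite -[LHS]addr0 -addrA; congr (_ + _); apply/esym.
  under eq_bigr => j _ do rewrite exprS -mulrA subSS.
  by rewrite -mulr_sumr -IHm mulNr addrN.
have dE : E^`() = \sum_i l i *: S i.
  rewrite /E deriv_bigprod; apply: eq_bigr => i _.
  by rewrite derivD derivZ derivX derivC add0r -scalerAl mul1r.
have := congr1 (fun P : {poly R} => P`_k) dE.
rewrite coef_deriv => ->; rewrite coef_sum.
under eq_bigr => i _ do rewrite coefZ Sk mulr_sumr.
rewrite exchange_big; apply: eq_bigr => j _ /=.
rewrite mulr_sumr mulr_suml; apply: eq_bigr => i _.
by rewrite [(- l i) ^+ j]exprNn exprS; ring.
Qed.

(** The binomial theorem splits each (x + y)^n into n+1 products of a function of S by a function of
    T, so the matrix has rank at most e (n+1). *)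
Lemma det_sum_powers (F : fieldType) (m e n : nat) (a : F)
    (x y : 'I_e -> 'I_m -> F) :
  (e * n.+1 < m)%N ->
  \det (\matrix_(S < m, T < m) (a * \sum_i (x i S + y i T) ^+ n)) = 0.
Proof.
move=> lt_em; set M := (X in \det X).
pose J := ('I_e * 'I_n.+1)%type.
pose P := \matrix_(S < m, r < #|{: J}|) (x (enum_val r).1 S ^+ (n - (enum_val r).2)).
pose Q := \matrix_(r < #|{: J}|, T < m)
  (a * (y (enum_val r).1 T ^+ (enum_val r).2 *+ 'C(n, (enum_val r).2))).
have MPQ : M = P *m Q.
  apply/matrixP => S T; rewrite !mxE.
  under [RHS]eq_bigr => r _ do rewrite !mxE.
  pose G (i : 'I_e) (k : 'I_n.+1) :=
    x i S ^+ (n - k) * (a * (y i T ^+ k *+ 'C(n, k))).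
  rewrite -(big_enum_val (A := {: J}) (fun r : J => G r.1 r.2)) -(pair_bigA _ G) /=.
  rewrite mulr_sumr; apply: eq_bigr => i _; rewrite exprDn mulr_sumr.
  by apply: eq_bigr => k _; rewrite /G -mulrnAr mulrCA.
apply/eqP; rewrite -[_ == _]negbK -unitfE -unitmxE -row_free_unit /row_free neq_ltn.
apply/orP; left; rewrite MPQ; apply: leq_ltn_trans (mulmx_max_rank _ _) _.
by rewrite card_prod !card_ord.
Qed.

End Algebra.

(** * Limits along a filter *)

Section Limits.
Variables (K : numFieldType) (T : Type) (U : set_system T).
Context {UF : ProperFilter U}.

(* A record rather than a definition, so that unification and [apply:] do not
   unfold it to a statement about neighbourhoods. *)
Record tends (g : T -> K) (l : K) : Prop :=
  Tends { tends_cvg : (g x @[x --> U] --> l)%classic }.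

Lemma tends_cst (c : K) : tends (fun=> c) c.
Proof. by split; apply: cvg_cst. Qed.

Lemma tendsD f g a b :
  tends f a -> tends g b -> tends (fun x => f x + g x) (a + b).
Proof. by case=> fa [gb]; split; apply: cvgD. Qed.

Lemma tendsM f g a b :
  tends f a -> tends g b -> tends (fun x => f x * g x) (a * b).
Proof. by case=> fa [gb]; split; apply: cvgM. Qed.

Lemma tendsN f a : tends f a -> tends (fun x => - f x) (- a).
Proof. by case=> fa; split; apply: cvgN. Qed.

Lemma tendsB f g a b :
  tends f a -> tends g b -> tends (fun x => f x - g x) (a - b).
Proof. by move=> fa gb; apply: tendsD => //; apply: tendsN. Qed.

Lemma tendsV f a : a != 0 -> tends f a -> tends (fun x => (f x)^-1) a^-1.
Proof. by move=> a0 [fa]; split; apply: cvgV. Qed.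

Lemma tends_unique f a b : tends f a -> tends f b -> a = b.
Proof. by case=> fa [fb]; apply: norm_cvg_unique fa fb. Qed.

Lemma tends_near f g a :
  (\forall x \near U, f x = g x) -> tends f a -> tends g a.
Proof.
move=> fg [fa]; split; apply: cvg_trans fa; apply: near_eq_cvg.
by apply: filterS fg => x ->.
Qed.

Lemma tends_eq f g a : f =1 g -> tends f a -> tends g a.
Proof. by move=> fg; apply: tends_near; apply: nearW => x; exact: fg. Qed.

Lemma tends_neq0 f a : a != 0 -> tends f a -> \forall x \near U, f x != 0.
Proof. by move=> a0 [fa]; apply: cvgr_neq0 fa a0. Qed.

Lemma tends_sum (I : Type) (r : seq I) (P : pred I) (f : I -> T -> K) a :
  (forall i, P i -> tends (f i) (a i)) ->
  tends (fun x => \sum_(i <- r | P i) f i x) (\sum_(i <- r | P i) a i).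
Proof.
move=> fa; elim: r => [|i r IHr].
  by apply: tends_eq (tends_cst _) => x; rewrite !big_nil.
rewrite big_cons; case: ifPn => Pi; last first.
  by apply: tends_eq IHr => x; rewrite big_cons (negbTE Pi).
by apply: tends_eq (tendsD (fa _ Pi) IHr) => x; rewrite big_cons Pi.
Qed.

Lemma tends_prod (I : Type) (r : seq I) (P : pred I) (f : I -> T -> K) a :
  (forall i, P i -> tends (f i) (a i)) ->
  tends (fun x => \prod_(i <- r | P i) f i x) (\prod_(i <- r | P i) a i).
Proof.
move=> fa; elim: r => [|i r IHr].
  by apply: tends_eq (tends_cst _) => x; rewrite !big_nil.
rewrite big_cons; case: ifPn => Pi; last first.
  by apply: tends_eq IHr => x; rewrite big_cons (negbTE Pi).
by apply: tends_eq (tendsM (fa _ Pi) IHr) => x; rewrite big_cons Pi.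
Qed.

Lemma tendsX f a n : tends f a -> tends (fun x => f x ^+ n) (a ^+ n).
Proof.
move=> fa; elim: n => [|n IHn]; first exact: tends_cst.
rewrite exprS; apply: tends_eq (tendsM fa IHn) => x.
by rewrite exprS.
Qed.

Lemma tends_det n (M : T -> 'M[K]_n) (M0 : 'M[K]_n) :
  (forall i j, tends (fun x => M x i j) (M0 i j)) ->
  tends (fun x => \det (M x)) (\det M0).
Proof.
move=> MM0; apply: tends_sum => s _; apply: tendsM; first exact: tends_cst.
by apply: tends_prod => i _; apply: MM0.
Qed.

Definition ptends (P : T -> {poly K}) (Q : {poly K}) :=
  forall j, tends (fun x => (P x)`_j) Q`_j.

Lemma ptends_cst Q : ptends (fun=> Q) Q.
Proof. by move=> j; apply: tends_cst. Qed.

Lemma ptendsD P P' Q Q' :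
  ptends P Q -> ptends P' Q' -> ptends (fun x => P x + P' x) (Q + Q').
Proof.
move=> PQ PQ' j; rewrite coefD.
by apply: tends_eq (tendsD (PQ j) (PQ' j)) => x; rewrite coefD.
Qed.

Lemma ptendsM P P' Q Q' :
  ptends P Q -> ptends P' Q' -> ptends (fun x => P x * P' x) (Q * Q').
Proof.
move=> PQ PQ' j; rewrite coefM.
apply: (tends_eq (f := fun x => \sum_(i < j.+1) (P x)`_i * (P' x)`_(j - i))).
  by move=> x; rewrite coefM.
by apply: tends_sum => i _; apply: tendsM.
Qed.

Lemma ptendsC c a : tends c a -> ptends (fun x => (c x)%:P) a%:P.
Proof.
move=> ca j; rewrite coefC; apply: (tends_eq (f := fun x => if j == 0 then c x else 0)).
  by move=> x; rewrite coefC.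
by case: eqP => _ //; apply: tends_cst.
Qed.

Lemma ptendsZX c a : tends c a -> ptends (fun x => c x *: 'X) (a *: 'X).
Proof.
move=> ca; rewrite -mul_polyC.
move=> j; apply: tends_eq (ptendsM (ptendsC ca) (ptends_cst 'X) j) => x.
by rewrite mul_polyC.
Qed.

Lemma ptendsX P Q n : ptends P Q -> ptends (fun x => P x ^+ n) (Q ^+ n).
Proof.
move=> PQ; elim: n => [|n IHn]; first exact: ptends_cst.
move=> j; rewrite exprS; apply: tends_eq (ptendsM PQ IHn j) => x.
by rewrite exprS.
Qed.

Lemma ptends_sum (I : Type) (r : seq I) (f : I -> T -> {poly K}) a :
  (forall i, ptends (f i) (a i)) ->
  ptends (fun x => \sum_(i <- r) f i x) (\sum_(i <- r) a i).
Proof.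
move=> fa; elim: r => [|i r IHr] j.
  by apply: tends_eq (tends_cst _) => x; rewrite !big_nil.
by rewrite big_cons; apply: tends_eq (ptendsD (fa i) IHr j) => x; rewrite big_cons.
Qed.

Lemma ptends_prod (I : Type) (r : seq I) (f : I -> T -> {poly K}) a :
  (forall i, ptends (f i) (a i)) ->
  ptends (fun x => \prod_(i <- r) f i x) (\prod_(i <- r) a i).
Proof.
move=> fa; elim: r => [|i r IHr] j.
  by apply: tends_eq (tends_cst _) => x; rewrite !big_nil.
by rewrite big_cons; apply: tends_eq (ptendsM (fa i) IHr j) => x; rewrite big_cons.
Qed.

Definition on_line n (p q : 'I_n -> K) (G : {mpoly K[n]}) : {poly K} :=
  mmap (@polyC K) (fun i => (p i)%:P + q i *: 'X) G.

(** The degree bound [D], uniform in x, turns the restriction into a sum over one fixed finite set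
    of monomials. *)
Lemma ptends_on_line n D (G : T -> {mpoly K[n]}) (f : {mpoly K[n]})
    (p q0 : 'I_n -> K) (q : T -> 'I_n -> K) :
  (forall x, msize (G x) <= D)%N -> (msize f <= D)%N ->
  (forall m, tends (fun x => (G x)@_m) f@_m) ->
  (forall i, tends (fun x => q x i) (q0 i)) ->
  ptends (fun x => on_line p (q x) (G x)) (on_line p q0 f).
Proof.
move=> GD fD Gf qq0.
have -> : (fun x => on_line p (q x) (G x)) = fun x =>
    \sum_(m : 'X_{1..n < D}) ((G x)@_m)%:P *
       \prod_(i < n) ((p i)%:P + q x i *: 'X) ^+ (val m) i.
  by apply/funext => x; rewrite /on_line (mmapE _ (GD x)).
rewrite /on_line (mmapE _ fD).
apply: ptends_sum => m; apply: ptendsM; first exact/ptendsC/Gf.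
apply: ptends_prod => i; apply: ptendsX; apply: ptendsD.
  exact: ptends_cst.
exact/ptendsZX/qq0.
Qed.

End Limits.

(** * Restriction to lines *)

Section Lines.
Variable K : comNzRingType.

Definition dot (N : nat) (a q : 'I_N -> K) : K := \sum_j a j * q j.

Definition aff_line (N : nat) (a : 'I_N -> K) (b : K) (p q : 'I_N -> K) :
    {poly K} :=
  (dot a p + b)%:P + dot a q *: 'X.

Definition target_line (d : nat) (p q : 'I_(d + 2) -> K) : {poly K} :=
  \prod_(i < d) ((p (lshift 2 i))%:P + q (lshift 2 i) *: 'X) +
  \sum_(j < 2) ((p (rshift d j))%:P + q (rshift d j) *: 'X) ^+ d.

Lemma dotD N (a q q' : 'I_N -> K) :
  dot a (fun i => q i + q' i) = dot a q + dot a q'.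
Proof. by rewrite /dot -big_split; apply: eq_bigr => j _; rewrite mulrDr. Qed.

Lemma dot0 N (a : 'I_N -> K) : dot a (fun=> 0) = 0.
Proof. by rewrite /dot big1 // => j _; rewrite mulr0. Qed.

(** The factors other than the [i0]-th are multiples of tau and already account for tau^n, so the
    [i0]-th contributes its value at [p]; the two powers are constant along the line. *)
Lemma coef_target_line n (p q : 'I_(n.+1 + 2) -> K) (i0 : 'I_n.+1) :
  (0 < n)%N ->
  (forall j, p (lshift 2 (lift i0 j)) = 0) ->
  (forall j, q (rshift n.+1 j) = 0) ->
  (target_line p q)`_n =
  p (lshift 2 i0) * \prod_(j < n) q (lshift 2 (lift i0 j)).
Proof.
move=> n0 p0 q0; rewrite coefD coef_sum (bigD1_ord i0) //=.
rewrite (eq_bigr (fun j => q (lshift 2 (lift i0 j)) *: 'X)); last first.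
  by move=> j _; rewrite p0 add0r.
rewrite scaler_prod prodr_const card_ord -scalerAr coefZ mulrDl coefD.
rewrite coefCM coefXn eqxx mulr1 -scalerAl -exprS coefZ coefXn ltn_eqF //.
rewrite mulr0 addr0 [X in X + _]mulrC [X in _ + X]big1 ?addr0 // => j _.
by rewrite q0 scale0r addr0 -rmorphXn coefC gtn_eqF.
Qed.

End Lines.

(** A factor is 1 or -1 where the indicators of S and T agree and 0 where they differ, so the matrix
    is diagonal with entries C or -C. *)
Lemma det_indicators (F : numFieldType) (n : nat) (C : F) :
  let w S : {ffun 'I_n -> bool} := enum_val S in
  C != 0 ->
  \det (\matrix_(S < #|{: {ffun 'I_n -> bool}}|, T < #|{: {ffun 'I_n -> bool}}|)
     (C * \prod_j ((w S j)%:R + ((w T j)%:R - 1)))) != 0.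
Proof.
move=> w C0.
rewrite (_ : \matrix_(S, T) _ =
   diag_mx (\row_S (C * \prod_j ((w S j)%:R + ((w S j)%:R - 1))))); last first.
  apply/matrixP => S T; rewrite !mxE; case: (eqVneq S T) => [->//|neST].
  have /existsP[j Hj] : [exists j, w S j != w T j].
    apply: contraNT neST; rewrite negb_exists => /forallP eqST.
    by apply/eqP/enum_val_inj/ffunP => j; apply/eqP; move/negPn: (eqST j).
  have Wj : (w S j)%:R + ((w T j)%:R - 1) = 0 :> F.
    by move: Hj; case: (w S j); case: (w T j) => //= _; ring.
  by rewrite (bigD1 j) //= Wj mul0r mulr0 mulr0n.
rewrite det_diag; apply/prodf_neq0 => S _; rewrite mxE mulf_neq0 //.
apply/prodf_neq0 => j _; case: (w S j) => /=.
  by rewrite subrr addr0 oner_eq0.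
by rewrite sub0r add0r oppr_eq0 oner_eq0.
Qed.

(** * Two plane curves containing no line *)

Lemma poly_all_roots (K : numDomainType) (P : {poly K}) :
  (forall t, P.[t] = 0) -> P = 0.
Proof.
move=> rootP; apply/eqP/negPn/negP => P0.
pose s : seq K := [seq i%:R | i <- iota 0 (size P)].
have us : uniq s.
  rewrite map_inj_uniq ?iota_uniq // => i j /eqP.
  by rewrite eqr_nat => /eqP.
have /max_poly_roots : all (root P) s by apply/allP => t _; rewrite rootE rootP.
by move=> /(_ P0 us); rewrite size_map size_iota ltnn.
Qed.

(** At t = 0 the equation gives s^d = 1, so s is nonzero; the derivative at 0 then forces r = 0, and
    the derivative at 1, divided by d, reads 1 = 0. *)
Lemma fermat_no_line (K : numFieldType) (d : nat) (s r : K) : (1 < d)%N ->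
  ~ (forall t, (s + r * t) ^+ d + t ^+ d - 1 = 0).
Proof.
move=> d1 line.
have d0 : (0 < d)%N by apply: ltn_trans d1.
have dK : d%:R != 0 :> K by rewrite pnatr_eq0 -lt0n.
pose P : {poly K} := (s%:P + r *: 'X) ^+ d + 'X^d - 1.
have P0 : P = 0.
  by apply: poly_all_roots => t; rewrite /P !hornerE line.
have s0 : s != 0.
  apply: contraTneq isT => s0; have := line 0.
  by rewrite s0 mulr0 addr0 !expr0n gtn_eqF //= addr0 sub0r => /eqP; rewrite oppr_eq0 oner_eq0.
have dP t : r * (s + r * t) ^+ d.-1 + t ^+ d.-1 = 0.
  have := congr1 (fun P => P^`().[t]) P0.
  rewrite /P derivB derivC subr0 derivD deriv_exp derivXn derivD derivC derivZ derivX.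
  rewrite add0r hornerD !hornerMn -mulrnDl !hornerE deriv0 horner0 => /eqP.
  by rewrite mulrn_eq0 eqn0Ngt d0 => /eqP.
have d10 : d.-1 != 0%N by rewrite -lt0n -ltnS prednK.
have r0 : r = 0.
  have := dP 0; rewrite mulr0 addr0 expr0n (negbTE d10) addr0 => /eqP.
  by rewrite mulf_eq0 expf_eq0 (negbTE s0) andbF orbF => /eqP.
by have := dP 1; rewrite r0 mul0r add0r expr1n => /eqP; rewrite oner_eq0.
Qed.

(** Under equality everywhere, the values at 0 give c^e = 1 and the derivatives at 0 give b = 0 or e
    = 0; the power is then constantly 1, which fails at t = 1. *)
Lemma binomial_not_power (K : numFieldType) (d e : nat) (c b : K) : (1 < d)%N ->
  exists t, 1 + t ^+ d - (c + b * t) ^+ e != 0.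
Proof.
move=> d1; apply: contrapT => all0.
have line t : 1 + t ^+ d - (c + b * t) ^+ e = 0.
  by apply/eqP/negPn/negP => nz; apply: all0; exists t.
pose P : {poly K} := 1 + 'X^d - (c%:P + b *: 'X) ^+ e.
have P0 : P = 0.
  by apply: poly_all_roots => t; rewrite /P !hornerE line.
have d10 : (d.-1 != 0)%N by rewrite -lt0n -ltnS prednK // ltnW.
have c1 : c ^+ e = 1.
  have /eqP := line 0; rewrite mulr0 addr0 expr0n gtn_eqF ?(ltnW d1) // addr0.
  by rewrite subr_eq0 => /eqP.
have dP0 : b * c ^+ e.-1 *+ e = 0.
  have := congr1 (fun P => P^`().[0]) P0.
  rewrite /P derivB derivD derivC derivXn deriv_exp derivD derivC derivZ derivX.
  rewrite !add0r hornerD hornerN !hornerMn !hornerE expr0n (negbTE d10).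
  by rewrite mul0rn sub0r deriv0 horner0 => /eqP; rewrite oppr_eq0 => /eqP.
have be0 : b = 0 \/ e = 0%N.
  case: (posnP e) => [->|e0]; first by right.
  left; apply/eqP; move/eqP: dP0; rewrite mulrn_eq0 eqn0Ngt e0 /= mulf_eq0.
  case/orP => //; rewrite expf_eq0 => /andP[_ /eqP c0].
  by move/eqP: c1; rewrite c0 expr0n gtn_eqF // eq_sym oner_eq0.
have := line 1; have -> : (c + b * 1) ^+ e = 1.
  by case: be0 => ->; rewrite ?expr0 // mul0r addr0.
by rewrite expr1n addrK => /eqP; rewrite oner_eq0.
Qed.

(** * Limits of products of affine forms *)

(** The second case is divergence to infinity. Since the inverse of 0 is 0, eventual nonvanishing is
    asked separately. *)
Definition dichotomous (K : numFieldType) (T : Type) (U : set_system T) :=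
  forall g : T -> K, (exists l, tends U g l) \/
    ((\forall x \near U, g x != 0) /\ tends U (fun x => (g x)^-1) 0).

Section Normalization.
Variables (K : numFieldType) (T : Type) (U : set_system T).
Context {UF : ProperFilter U}.
Hypothesis dichU : dichotomous K U.

Lemma tends_norm (f : T -> K) a : tends U f a -> tends U (fun x => `|f x|) `|a|.
Proof. by case=> fa; split; apply: cvg_norm. Qed.

Lemma tends0_lt1 (f : T -> K) : tends U f 0 -> \forall x \near U, `|f x| < 1.
Proof.
case=> /cvgrPdist_lt /(_ 1 ltr01); apply: filterS => x.
by rewrite sub0r normrN.
Qed.

Lemma bounded_tends (g : T -> K) :
  (forall x, `|g x| <= 1) -> exists l, tends U g l.
Proof.
move=> g1; case: (dichU g) => // -[g0 /tends0_lt1 gV].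
have [x [gx]] := filter_ex (filterI g0 gV).
rewrite normfV invf_lt1 ?normr_gt0 // => /lt_le_trans/(_ (g1 x)).
by rewrite ltxx.
Qed.

(** Dividing by the l^1 norm bounds the coordinates, so they converge; their absolute values keep a
    sum of at least 1, so some limit is nonzero. *)
Lemma normalization m (a : T -> 'I_m.+1 -> K) :
  exists (N : T -> K) (v : T -> 'I_m.+1 -> K) (v0 : 'I_m.+1 -> K),
    [/\ forall x j, a x j = N x * v x j,
        forall j, tends U (fun x => v x j) (v0 j) &
        exists k, v0 k != 0].
Proof.
pose N x := \sum_j `|a x j|.
(* Where [N x] vanishes so does [a x]; the default 1 keeps [v x] away from 0 there. *)
pose v x j := if N x == 0 then 1 else a x j / N x.
have N0 x : 0 <= N x by apply: sumr_ge0 => j _.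
have aN x j : `|a x j| <= N x.
  by rewrite /N (bigD1 j) //= lerDl sumr_ge0.
have v1 x j : `|v x j| <= 1.
  rewrite /v; case: eqP => [_|/eqP Nx]; first by rewrite normr1.
  rewrite normrM normfV (ger0_norm (N0 x)) ler_pdivrMr ?mul1r //.
  by rewrite lt_def Nx N0.
have sv x : 1 <= \sum_j `|v x j|.
  rewrite /v; case: eqP => [_|/eqP Nx].
    by rewrite (bigD1 ord0) //= normr1 lerDl sumr_ge0.
  under eq_bigr => j _ do rewrite normrM normfV (ger0_norm (N0 x)).
  by rewrite -mulr_suml divff.
have /choice [v0 vv0] j : exists l, tends U (fun x => v x j) l.
  exact: bounded_tends.
exists N, v, v0; split=> // [x j|].
  rewrite /v; case: eqP => [Nx|/eqP Nx]; last by rewrite mulrCA divff // mulr1.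
  by rewrite Nx mul0r; apply/eqP; rewrite -normr_le0 -Nx aN.
apply: contrapT => all0.
have v00 j : v0 j = 0.
  by apply/eqP/negPn/negP => vj; apply: all0; exists j.
have : tends U (fun x => \sum_j `|v x j|) 0.
  rewrite -[X in tends _ _ X](_ : \sum_(j < m.+1) (0 : K) = 0); last by rewrite big1.
  apply: tends_sum => j _; have := tends_norm (vv0 j).
  by rewrite v00 normr0.
move=> /tends0_lt1 sv1; have [x] := filter_ex sv1.
have := sv x; rewrite ger0_norm ?sumr_ge0 // => s1 /(le_lt_trans s1).
by rewrite ltxx.
Qed.

(** After normalization every factor has a nonzero limit form [u0 i], and F is a constant times
    their product: either all these forms are constant, or the zero line of one of them lies in F =
    0. *)
Lemma product_of_affine_limit e (c0 c1 c2 : 'I_e -> T -> K) (F : K -> K -> K) :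
  (forall s t, tends U
     (fun x => \prod_i (c0 i x + c1 i x * s + c2 i x * t)) (F s t)) ->
  [\/ forall s t s' t', F s t = F s' t',
      exists s0 r, forall t, F (s0 + r * t) t = 0 |
      exists t0 r, forall s, F s (t0 + r * s) = 0].
Proof.
move=> limF.
pose o0 : 'I_3 := ord0; pose o2 : 'I_3 := ord_max; pose o1 : 'I_3 := inord 1.
pose a i x (j : 'I_3) := if j == 0 :> nat then c0 i x else
   if j == 1 :> nat then c1 i x else c2 i x.
have /choice [N /choice [v /choice [v0 H]]] i := normalization (a i).
have aE i : [/\ c0 i = fun x => N i x * v i x o0, c1 i = fun x => N i x * v i x o1
    & c2 i = fun x => N i x * v i x o2].
  have [aN _ _] := H i.
  split; apply/funext => x; rewrite -aN /a //=; by rewrite inordK.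
have vt i j : tends U (fun x => v i x j) (v0 i j) by have [_ + _] := H i; apply.
have inord1 (k : 'I_3) : [\/ k = o0, k = o1 | k = o2].
  case: k => [[|[|[|k]]] lt] //.
  - by apply: Or31; apply: val_inj.
  - by apply: Or32; apply: val_inj; rewrite /= inordK.
  - by apply: Or33; apply: val_inj.
(* The limit form on the curve (t, t^2), where it does not vanish identically. *)
pose w i := (v0 i o0)%:P + v0 i o1 *: 'X + v0 i o2 *: 'X^2 : {poly K}.
have w0 i : w i != 0.
  have [_ _ [k vk]] := H i; apply: contraNneq vk => wi0.
  have cf j : (w i)`_j = 0 by rewrite wi0 coef0.
  have := cf 0%N; have := cf 1%N; have := cf 2%N; rewrite /w !coefE /=.
  rewrite !mulr0 !mulr1 !addr0 !add0r => v2 v1 v00.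
  by case: (inord1 k) => ->; apply/eqP.
have [t0 wt0] : exists t0, \prod_i (w i).[t0] != 0.
  apply: contrapT => all0.
  have /eqP : \prod_i w i = 0.
    apply: poly_all_roots => t; rewrite horner_prod.
    by apply/eqP/negPn/negP => nz; apply: all0; exists t.
  by apply/negP/prodf_neq0 => i _; apply: w0.
pose u i x s t := v i x o0 + v i x o1 * s + v i x o2 * t.
pose u0 i s t := v0 i o0 + v0 i o1 * s + v0 i o2 * t.
have ut s t : tends U (fun x => \prod_i u i x s t) (\prod_i u0 i s t).
  apply: tends_prod => i _; apply: tendsD; first apply: tendsD => //.
    by apply: tendsM (vt i o1) (tends_cst s).
  by apply: tendsM (vt i o2) (tends_cst t).
have cE s t x : \prod_i (c0 i x + c1 i x * s + c2 i x * t) =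
    (\prod_i N i x) * \prod_i u i x s t.
  rewrite -big_split; apply: eq_bigr => i _ /=.
  by have [-> -> ->] := aE i; rewrite /u !mulrDr !mulrA.
have ut0 : \prod_i u0 i t0 (t0 ^+ 2) != 0.
  rewrite (eq_bigr (fun i => (w i).[t0])) // => i _.
  by rewrite /w !hornerE /u0 /= expr2 mulrA.
(* One point where the product of the limit forms is nonzero shows that the product of the scalars
   converges, although each scalar alone may not. *)
pose M0 := F t0 (t0 ^+ 2) / \prod_i u0 i t0 (t0 ^+ 2).
have NM0 : tends U (fun x => \prod_i N i x) M0.
  pose proof (tendsM (limF t0 (t0 ^+ 2)) (tendsV ut0 (ut t0 (t0 ^+ 2)))) as lim.
  apply: tends_near lim; apply: filterS (tends_neq0 ut0 (ut _ _)) => x ux.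
  by rewrite cE -mulrA divff // mulr1.
have FE s t : F s t = M0 * \prod_i u0 i s t.
  apply: tends_unique (limF s t) _.
  by apply: tends_eq (tendsM NM0 (ut s t)) => x; rewrite cE.
have F0 i s t : u0 i s t = 0 -> F s t = 0.
  by move=> ui; rewrite FE (bigD1 i) //= ui mul0r mulr0.
have [[i vi]|no1] := pselect (exists i, v0 i o1 != 0).
  apply: Or32; exists (- v0 i o0 / v0 i o1), (- v0 i o2 / v0 i o1) => t.
  by apply: (F0 i); rewrite /u0; field.
have [[i vi]|no2] := pselect (exists i, v0 i o2 != 0).
  apply: Or33; exists (- v0 i o0 / v0 i o2), (- v0 i o1 / v0 i o2) => s.
  by apply: (F0 i); rewrite /u0; field.
apply: Or31 => s t s' t'; rewrite !FE; congr (_ * _); apply: eq_bigr => i _; rewrite /u0.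
have -> : v0 i o1 = 0 by apply/eqP/negPn/negP => nz; apply: no1; exists i.
have -> : v0 i o2 = 0 by apply/eqP/negPn/negP => nz; apply: no2; exists i.
by rewrite !mul0r.
Qed.
End Normalization.

(** * The rank bound *)

Section Degeneration.
Variables (K : numFieldType) (T : Type) (U : set_system T).
Context {UF : ProperFilter U}.
Variables (n e : nat).
Notation N := (n.+1 + 2)%N.
(** [al i] and [be i] are the linear part and constant term of the i-th factor of the product, [al0]
    and [be0] those of the form raised to the power e; the degree d is [n.+1]. *)
Variables (al : 'I_e -> T -> 'I_N -> K) (be : 'I_e -> T -> K).
Variables (al0 : T -> 'I_N -> K) (be0 : T -> K).
Hypothesis n_gt0 : (0 < n)%N.
Hypothesis e_gt0 : (0 < e)%N.
Hypothesis lim_line : forall p q q0, (forall i, tends U (fun x => q x i) (q0 i)) ->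
  ptends U (fun x => \prod_(i < e) aff_line (al i x) (be i x) p (q x) +
                     aff_line (al0 x) (be0 x) p (q x) ^+ e) (target_line p q0).

Lemma eval_limit p : tends U
  (fun x => \prod_(i < e) (dot (al i x) p + be i x) +
            (dot (al0 x) p + be0 x) ^+ e)
  (\prod_(i < n.+1) p (lshift 2 i) + \sum_(j < 2) p (rshift n.+1 j) ^+ n.+1).
Proof.
pose proof (lim_line p (q := fun _ _ => 0) (fun=> tends_cst 0) 0%N) as lim.
move: lim.
rewrite /target_line -horner_coef0 hornerD horner_prod horner_sum.
under eq_bigr do rewrite scale0r addr0 hornerC.
under [X in _ + X]eq_bigr do rewrite horner_exp scale0r addr0 hornerC.
apply: tends_eq => x; rewrite -horner_coef0 hornerD horner_prod horner_exp.
rewrite /aff_line dot0 scale0r addr0 hornerC; congr (_ + _).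
by apply: eq_bigr => i _; rewrite dot0 scale0r addr0 hornerC.
Qed.

(** * Newton's identities along lines through a point of divergence *)

Section Escape.
Variables (i0 : 'I_n.+1) (p : 'I_N -> K).
Variables (Q : T -> ('I_n -> K) -> 'I_N -> K) (Q0 : ('I_n -> K) -> 'I_N -> K).
Hypothesis p_i0 : p (lshift 2 i0) != 0.
Hypothesis p_lift : forall j, p (lshift 2 (lift i0 j)) = 0.
Hypothesis QD : forall x w w',
  Q x (fun j => w j + w' j) = fun k => Q x w k + Q x w' k.
Hypothesis QQ0 : forall w k, tends U (fun x => Q x w k) (Q0 w k).
Hypothesis Q0_lift : forall w j, Q0 w (lshift 2 (lift i0 j)) = w j.
Hypothesis Q0_powers : forall w j, Q0 w (rshift n.+1 j) = 0.
Hypothesis dotQ : \forall x \near U, forall w, dot (al0 x) (Q x w) = 0.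
Let c x := dot (al0 x) p + be0 x.
Hypothesis c_neq0 : \forall x \near U, c x != 0.
Hypothesis cV0 : tends U (fun x => (c x)^-1) 0.

Let a x := \prod_i (dot (al i x) p + be i x).

(** At [p], [a + c ^ e] converges while [c] diverges, so dividing by [c ^ e] gives this limit. It
    forces [a] to diverge. *)
Let ac1 : tends U (fun x => a x * (c x)^-1 ^+ e) (- 1).
Proof.
pose proof (tendsM (eval_limit p) (tendsX e cV0)) as lim0.
pose proof (tendsB lim0 (tends_cst 1)) as lim1; move: lim1.
rewrite expr0n gtn_eqF // mulr0 sub0r; apply: tends_near.
by apply: filterS c_neq0 => x cx; rewrite mulrDl -exprMn divff // expr1n addrK.
Qed.

Let a_neq0 : \forall x \near U, a x != 0.
Proof.
have /tends_neq0 : tends U (fun x => a x * (c x)^-1 ^+ e) (- 1) by exact: ac1.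
rewrite oppr_eq0 oner_eq0 => /(_ isT); apply: filterS => x.
by rewrite mulf_eq0 => /norP[].
Qed.

Let aV0 : tends U (fun x => (a x)^-1) 0.
Proof.
have n1 : - 1 != 0 :> K by rewrite oppr_eq0 oner_eq0.
pose proof (tendsM (tendsV n1 ac1) (tendsX e cV0)) as lim; move: lim.
rewrite expr0n gtn_eqF // mulr0; apply: tends_near.
apply: filterS2 c_neq0 a_neq0 => x cx ax.
by rewrite invfM -mulrA mulVf ?mulr1 // expf_neq0 // invr_eq0.
Qed.

(** Slopes of the factors scaled to take the value 1 at [p]: near [U], the product along the line is
    [a x] times [E x w]. *)
Let la i x w := dot (al i x) (Q x w) / (dot (al i x) p + be i x).
Let E x w := \prod_i (1 + la i x w *: 'X).
Let psum k x w := \sum_i la i x w ^+ k.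

(** The form raised to the power e is constant along these lines, so it affects only the coefficient
    of degree 0. *)
Let aE w j : tends U (fun x => a x * (E x w)`_j.+1) (target_line p (Q0 w))`_j.+1.
Proof.
have := lim_line p (QQ0 w) j.+1; apply: tends_near.
apply: filterS2 a_neq0 dotQ => x ax dQ.
rewrite {2}/aff_line dQ scale0r addr0 -rmorphXn /= coefD coefC /= addr0.
rewrite -coefZ; congr (_ `_ _); rewrite /a /E -scaler_prod.
congr polyseq; apply: eq_bigr => i _.
have : dot (al i x) p + be i x != 0.
  by move: ax; rewrite /a; move/prodf_neq0; apply.
by move=> ne0; rewrite /aff_line scalerDr scalerA /la mulrCA divff // mulr1 alg_polyC.
Qed.

Let E0 w j : tends U (fun x => (E x w)`_j.+1) 0.
Proof.
pose proof (tendsM aV0 (aE w j)) as lim; move: lim; rewrite mul0r; apply: tends_near.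
by apply: filterS a_neq0 => x ax; rewrite mulrA mulVf // mul1r.
Qed.

(** In Newton's identity multiplied by [a], each mixed term is a convergent [a * psum] times a
    coefficient of [E] that tends to 0; only the last power sum survives. *)
Let apsum w k : tends U (fun x => a x * psum k.+1 x w)
  ((-1) ^+ k * (target_line p (Q0 w))`_k.+1 *+ k.+1).
Proof.
elim/ltn_ind: k => k IHk.
have Esum : tends U
    (fun x => \sum_(j < k) (-1) ^+ j * (a x * psum j.+1 x w) * (E x w)`_(k - j)) 0.
  have sum0 : \sum_(j < k) (0 : K) = 0 by rewrite big1.
  rewrite -[X in tends _ _ X]sum0; apply: tends_sum => j _.
  have := E0 w (k - j).-1; rewrite prednK ?subn_gt0 // => Ej.
  pose proof (tendsM (tendsM (tends_cst ((-1) ^+ j)) (IHk _ (ltn_ord j))) Ej) as lim.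
  by rewrite mulr0 in lim.
pose proof (tendsM (tends_cst ((-1) ^+ k))
  (tendsB (tendsM (aE w k) (tends_cst k.+1%:R)) Esum)) as lim; move: lim.
rewrite subr0 mulr_natr -mulrnAr; apply: tends_eq => x.
have Nk : (E x w)`_k.+1 *+ k.+1 =
    \sum_(j < k.+1) (-1) ^+ j * psum j.+1 x w * (E x w)`_(k - j).
  exact: newton_identity.
rewrite big_ord_recr /= subnn in Nk.
have E00 : (E x w)`_0 = 1.
  rewrite -horner_coef0 horner_prod big1 // => i _.
  by rewrite !hornerE.
have -> : \sum_(j < k) (-1) ^+ j * (a x * psum j.+1 x w) * (E x w)`_(k - j) =
    a x * \sum_(j < k) (-1) ^+ j * psum j.+1 x w * (E x w)`_(k - j).
  by rewrite mulr_sumr; apply: eq_bigr => j _; rewrite [_ * (a x * _)]mulrCA !mulrA.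
set P := psum k.+1 x w in Nk *; set S := \sum_(j < k) _ in Nk *.
rewrite -[a x * _ * _]mulrA mulr_natr Nk E00 mulr1 -mulrBr addrAC subrr add0r.
by rewrite mulrCA; congr (_ * _); rewrite mulrA -expr2 sqrr_sign mul1r.
Qed.

(** [la] is additive in w, so the power sums at [u S + v S'] form a matrix as in [det_sum_powers],
    singular if e (n+1) < 2^n, whereas its limit is the invertible matrix of [det_indicators]. *)
Lemma escape_bound : (2 ^ n <= e * n.+1)%N.
Proof.
rewrite leqNgt; apply/negP => lt_e.
(* The constant given by [apsum] at k = n - 1 combined with [coef_target_line]. *)
pose C := (-1) ^+ n.-1 * p (lshift 2 i0) *+ n.
have C0 : C != 0.
  by rewrite /C -mulr_natr !mulf_neq0 ?signr_eq0 // pnatr_eq0 -lt0n.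
pose w (S : 'I_#|{: {ffun 'I_n -> bool}}|) := enum_val S.
pose u S j : K := (w S j)%:R.
pose v S j : K := (w S j)%:R - 1.
pose M x := \matrix_(S, S') (a x * \sum_i (la i x (u S) + la i x (v S')) ^+ n).
have M0 x : \det (M x) = 0.
  by apply: det_sum_powers; rewrite card_ffun card_bool !card_ord.
have /negP := det_indicators n C0; apply; apply/eqP.
apply: (tends_unique (f := fun x => \det (M x)) (U := U)); last first.
  by apply: tends_eq (tends_cst 0) => x; rewrite M0.
have FL z : (target_line p (Q0 z))`_n = p (lshift 2 i0) * \prod_j z j.
  rewrite (coef_target_line n_gt0 p_lift) //; congr (_ * _).
  by apply: eq_bigr => j _; rewrite Q0_lift.
apply: tends_det => S S'; rewrite mxE.
have := apsum (fun j => u S j + v S' j) n.-1; rewrite prednK //.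
rewrite FL mulrA -mulrnAl; apply: tends_eq => x; rewrite mxE; congr (_ * _).
by apply: eq_bigr => i _; rewrite /la QD dotD mulrDl.
Qed.

End Escape.

(** * Choice of the point and directions when the power diverges *)

Hypothesis dichU : dichotomous K U.

Definition point (xs : 'I_n.+1 -> K) (y z : K) (m : 'I_N) : K :=
  match fintype.split m with
  | inl i => xs i
  | inr j => if j == 0 :> nat then y else z
  end.

Let yi : 'I_N := rshift n.+1 (ord0 : 'I_2).
Let zi : 'I_N := rshift n.+1 (ord_max : 'I_2).

Lemma point_lshift xs y z i : point xs y z (lshift 2 i) = xs i.
Proof. by rewrite /point (unsplitK (inl i)). Qed.

Lemma point_rshift xs y z j :
  point xs y z (rshift n.+1 j) = if j == 0 :> nat then y else z.
Proof. by rewrite /point (unsplitK (inr j)). Qed.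

Lemma dot_point a xs y z :
  dot a (point xs y z) =
  \sum_i a (lshift 2 i) * xs i + a yi * y + a zi * z.
Proof.
rewrite /dot big_split_ord /= -addrA; congr (_ + _).
  by apply: eq_bigr => i _; rewrite point_lshift.
rewrite big_ord_recl big_ord1 !point_rshift /=; congr (_ * _ + a _ * _).
by apply: val_inj.
Qed.

Lemma dot_pick (a : 'I_N -> K) k t :
  dot a (fun m => if m == k then t else 0) = a k * t.
Proof.
rewrite /dot (bigD1 k) //= eqxx big1 ?addr0 // => j /negbTE ->.
by rewrite mulr0.
Qed.

(* The coordinate k is used to bring a direction into the hyperplane v = 0, and
   i0 is the product variable that is not free in the directions. *)
Section Pivot.
Variables (i0 : 'I_n.+1) (k : 'I_N) (p0 : 'I_N -> K).
Variables (v : T -> 'I_N -> K) (v0 : 'I_N -> K) (M : T -> K).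
Hypothesis al0E : forall x j, al0 x j = M x * v x j.
Hypothesis vv0 : forall j, tends U (fun x => v x j) (v0 j).
Hypothesis v0k : v0 k != 0.
Hypothesis unbounded : ~ exists a0 b0,
  (forall j, tends U (fun x => al0 x j) (a0 j)) /\ tends U be0 b0.
Hypothesis k_lift : forall j, lshift 2 (lift i0 j) != k.
Hypothesis p0_lift : forall j, p0 (lshift 2 (lift i0 j)) = 0.
Hypothesis p0_i0 : forall t, t != 0 ->
  p0 (lshift 2 i0) + (if lshift 2 i0 == k then t else 0) != 0.

Let p t m := p0 m + (if m == k then t else 0).
Let c t x := dot (al0 x) (p t) + be0 x.

(** If the form converged at both [p 1] and [p 2], the difference of its values would make [M]
    converge, hence [al0] and [be0] too. *)
Lemma exists_escaping_point : exists2 t, t != 0 &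
  (\forall x \near U, c t x != 0) /\ tends U (fun x => (c t x)^-1) 0.
Proof.
have [[l1 c1]|esc] := dichU (c 1); last by exists 1; rewrite ?oner_eq0.
have [[l2 c2]|esc] := dichU (c 2); last by exists 2; rewrite ?pnatr_eq0.
case: unbounded.
have cE t x : c t x = dot (al0 x) p0 + al0 x k * t + be0 x.
  by rewrite /c /p dotD dot_pick.
have Mlim : tends U M ((l2 - l1) / v0 k).
  pose proof (tendsM (tendsB c2 c1) (tendsV v0k (vv0 k))) as lim.
  apply: tends_near lim; apply: filterS (tends_neq0 v0k (vv0 k)) => x vk.
  by rewrite !cE al0E; field.
pose a0 j := (l2 - l1) / v0 k * v0 j.
have al0lim j : tends U (fun x => al0 x j) (a0 j).
  by apply: tends_eq (tendsM Mlim (vv0 j)) => x; rewrite al0E.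
exists a0, (l1 - dot a0 (p 1)); split=> //.
have dlim : tends U (fun x => dot (al0 x) (p 1)) (dot a0 (p 1)).
  by apply: tends_sum => j _; apply: tendsM (al0lim j) (tends_cst _).
by apply: tends_eq (tendsB c1 dlim) => x; rewrite /c addrAC subrr add0r.
Qed.

Let W (w : 'I_n -> K) := point (fun i => if unlift i0 i is Some j then w j else 0) 0 0.

(** When the pivot is a power variable, the correction along it vanishes in the limit, so limit
    directions still fix both power variables. *)
Hypothesis v0W : forall w j, rshift n.+1 j == k -> dot v0 (W w) = 0.

Let WD w w' m : W (fun j => w j + w' j) m = W w m + W w' m.
Proof.
rewrite /W /point; case: fintype.split => [i|j]; last by case: ifP; rewrite addr0.
by case: unlift => // ; rewrite addr0.
Qed.

Lemma pivot_bound : (2 ^ n <= e * n.+1)%N.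
Proof.
have [t t0 [ct ctV]] := exists_escaping_point.
pose Q x w m := W w m + (if m == k then - (dot (v x) (W w) / v x k) else 0).
pose Q0 w m := W w m + (if m == k then - (dot v0 (W w) / v0 k) else 0).
have W_lift w j : W w (lshift 2 (lift i0 j)) = w j.
  by rewrite /W point_lshift liftK.
apply: (@escape_bound i0 (p t) Q Q0) => //.
- exact: p0_i0.
- by move=> j; rewrite /p p0_lift (negbTE (k_lift j)) addr0.
- move=> x w w'; apply/funext => m; rewrite /Q WD.
  have -> : dot (v x) (W (fun j => w j + w' j)) = dot (v x) (W w) + dot (v x) (W w').
    by rewrite -dotD; congr dot; apply/funext => j; rewrite WD.
  by case: ifP => _; rewrite ?mulrDl; ring.
- move=> w m; apply: tendsD; first exact: tends_cst.
  case: ifP => _; last exact: tends_cst.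
  apply: tendsN; apply: tendsM; last exact: tendsV.
  by apply: tends_sum => j _; apply: tendsM (tends_cst _).
- by move=> w j; rewrite /Q0 W_lift (negbTE (k_lift j)) addr0.
- move=> w j; rewrite /Q0 /W point_rshift if_same add0r.
  by case: ifP => // /v0W ->; rewrite mul0r oppr0.
- apply: filterS (tends_neq0 v0k (vv0 k)) => x vk w.
  have -> : dot (al0 x) (Q x w) = M x * dot (v x) (Q x w).
    by rewrite /dot mulr_sumr; apply: eq_bigr => j _; rewrite al0E mulrA.
  by rewrite /Q dotD dot_pick mulrN mulrCA divff // mulr1 subrr mulr0.
Qed.

End Pivot.

Lemma unbounded_power_bound :
  ~ (exists a0 b0, (forall j, tends U (fun x => al0 x j) (a0 j)) /\
                   tends U be0 b0) ->
  (2 ^ n <= e * n.+1)%N.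
Proof.
move=> unbd.
have [M [v [v0 [al0E vv0 [k vk]]]]] :
    exists (M : T -> K) (v : T -> 'I_N -> K) (v0 : 'I_N -> K),
    [/\ forall x j, al0 x j = M x * v x j,
        forall j, tends U (fun x => v x j) (v0 j) & exists k, v0 k != 0].
  exact: (normalization dichU al0).
have [[i vi]|no_x] := pselect (exists i, v0 (lshift 2 i) != 0).
  (* The variable x_i serves both as pivot and as [i0]; moving the origin along it makes this
     coordinate nonzero. *)
  apply: (@pivot_bound i (lshift 2 i) (fun=> 0) v v0 M) => //.
  - by move=> j; rewrite eq_lshift eq_sym neq_lift.
  - by move=> t t0; rewrite eqxx add0r.
  - by move=> w j; rewrite eq_rlshift.
have v0x i : v0 (lshift 2 i) = 0.
  by apply/eqP/negPn/negP => nz; apply: no_x; exists i.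
case: (split_ordP k) vk => j ->; first by rewrite v0x eqxx.
move=> vj.
(* The limit form involves power variables only, so the pivot is one of them; the base point has
   first coordinate 1 to keep the [i0] factor nonzero. *)
apply: (@pivot_bound ord0 (rshift n.+1 j) (point (fun i => (i == ord0)%:R) 0 0) v v0 M) => //.
- by move=> i; rewrite eq_lrshift.
- by move=> i; rewrite point_lshift.
- by move=> t t0; rewrite point_lshift eqxx eq_lrshift addr0 oner_eq0.
- move=> w j' _; rewrite dot_point !mulr0 !addr0 big1 // => i _.
  by rewrite v0x mul0r.
Qed.

(** * Contradiction when the power converges *)

Section BoundedPower.
Variables (a0 : 'I_N -> K) (b0 : K).
Hypothesis al0_lim : forall j, tends U (fun x => al0 x j) (a0 j).
Hypothesis be0_lim : tends U be0 b0.

Lemma product_limit p : tends U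
  (fun x => \prod_(i < e) (dot (al i x) p + be i x))
  (\prod_(i < n.+1) p (lshift 2 i) + \sum_(j < 2) p (rshift n.+1 j) ^+ n.+1 -
   (dot a0 p + b0) ^+ e).
Proof.
have pow : tends U (fun x => (dot (al0 x) p + be0 x) ^+ e) ((dot a0 p + b0) ^+ e).
  apply: tendsX; apply: tendsD => //.
  by apply: tends_sum => j _; apply: tendsM (al0_lim j) (tends_cst _).
by apply: tends_eq (tendsB (eval_limit p) pow) => x; rewrite addrK.
Qed.

Lemma product_limit_point xs y z : tends U
  (fun x => \prod_(i < e) (dot (al i x) (point xs y z) + be i x))
  (\prod_i xs i + (y ^+ n.+1 + z ^+ n.+1) - (dot a0 (point xs y z) + b0) ^+ e).
Proof.
have := product_limit (point xs y z).
have -> : \sum_(j < 2) point xs y z (rshift n.+1 j) ^+ n.+1 = y ^+ n.+1 + z ^+ n.+1.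
  by rewrite big_ord_recl big_ord1 !point_rshift.
have -> : \prod_i point xs y z (lshift 2 i) = \prod_i xs i.
  by apply: eq_bigr => i _; rewrite point_lshift.
by [].
Qed.

Lemma bounded_power_absurd : False.
Proof.
have n1 : (1 < n.+1)%N by [].
have [[i ai]|no_x] := pselect (exists i, a0 (lshift 2 i) != 0).
  (* x_i is solved from a0 . x + b0 = 1 and the other x_j are 0. As n > 0 there is such a j, so the
     product vanishes and s^d + t^d - 1 remains. *)
  pose xs (s t : K) j := if j == i then (1 - b0 - a0 yi * s - a0 zi * t) / a0 (lshift 2 i)
                   else 0.
  have dot_xs a s t : dot a (point (xs s t) s t) =
      a (lshift 2 i) * ((1 - b0 - a0 yi * s - a0 zi * t) / a0 (lshift 2 i)) +
      a yi * s + a zi * t.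
    rewrite dot_point (bigD1 i) //= {1}/xs eqxx big1 ?addr0 // => j ji.
    by rewrite /xs (negbTE ji) mulr0.
  pose g j x (k : 'I_N) := al j x k - al j x (lshift 2 i) * a0 k / a0 (lshift 2 i).
  have := @product_of_affine_limit _ _ _ _ dichU e
    (fun j x => be j x + al j x (lshift 2 i) * (1 - b0) / a0 (lshift 2 i))
    (fun j x => g j x yi) (fun j x => g j x zi)
    (fun s t => s ^+ n.+1 + t ^+ n.+1 - 1).
  case => [s t|H|[s0 [r H]]|[t0 [r H]]].
  - have := product_limit_point (xs s t) s t; rewrite dot_xs.
    have -> : \prod_j xs s t j = 0.
      apply/eqP; rewrite prodf_seq_eq0; apply/hasP.
      have [j ji] : exists j, j != i.
        by exists (lift i (Ordinal n_gt0)); rewrite eq_sym neq_lift.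
      by exists j; rewrite ?mem_index_enum //= /xs (negbTE ji).
    rewrite (_ : _ + b0 = 1); last by field.
    rewrite add0r expr1n; apply: tends_eq => x; apply: eq_bigr => j _.
    by rewrite dot_xs /g; field.
  - have /eqP := H 1 0 0 0; rewrite !expr0n /= !expr1n add0r addr0 subrr sub0r.
    by rewrite eq_sym oppr_eq0 oner_eq0.
  - exact: (fermat_no_line n1 H).
  - apply: (@fermat_no_line _ n.+1 t0 r n1) => t.
    by have := H t; rewrite [t ^+ _ + _]addrC.
have a0x i : a0 (lshift 2 i) = 0.
  by apply/eqP/negPn/negP => nz; apply: no_x; exists i.
(* The limit form does not involve the x_i. With y = 1, z = [z0], the first and last x_i equal to s
   and t and the others to 1, the limit is s t + C. *)
have [z0 nz] := binomial_not_power e (a0 yi + b0) (a0 zi) n1.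
set C := 1 + _ - _ in nz.
pose xs (s t : K) (j : 'I_n.+1) := if j == ord0 then s else if j == ord_max then t else 1.
have om : ord_max != ord0 :> 'I_n.+1 by rewrite -val_eqE /= -lt0n.
pose S j x := \sum_(k < n.+1 | (k != ord0) && (k != ord_max)) al j x (lshift 2 k).
have := @product_of_affine_limit _ _ _ _ dichU e
  (fun j x => S j x + al j x yi + al j x zi * z0 + be j x)
  (fun j x => al j x (lshift 2 ord0)) (fun j x => al j x (lshift 2 ord_max))
  (fun s t => s * t + C).
case => [s t|H|[s0 [r H]]|[t0 [r H]]].
- have := product_limit_point (xs s t) 1 z0.
  rewrite (_ : \prod_j xs s t j = s * t); last first.
    rewrite (bigD1 ord0) //= (bigD1 ord_max) //= /xs eqxx (negbTE om) eqxx.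
    rewrite big1 ?mulr1 // => j /andP[j0 jm].
    by rewrite (negbTE j0) (negbTE jm).
  rewrite dot_point big1 => [|j _]; last by rewrite a0x mul0r.
  rewrite expr1n add0r mulr1 [a0 yi + _ + b0]addrAC -[s * t + _ - _]addrA -/C.
  apply: tends_eq => x; apply: eq_bigr => j _.
  rewrite dot_point (bigD1 ord0) //= (bigD1 ord_max) //= {1 2}/xs eqxx (negbTE om) eqxx.
  rewrite (eq_bigr (fun k => al j x (lshift 2 k))); first by rewrite -/(S j x); ring.
  by move=> k /andP[k0 km]; rewrite /xs (negbTE k0) (negbTE km) mulr1.
- have /eqP := H 1 1 0 0; rewrite mulr1 mulr0 add0r -subr_eq0 addrK.
  by rewrite oner_eq0.
(* At parameter 0 one of the two coordinates vanishes, leaving C = 0. *)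
- by move: nz; rewrite -(H 0) mulr0 add0r eqxx.
- by move: nz; rewrite -(H 0) mul0r add0r eqxx.
Qed.

End BoundedPower.

Lemma degeneration_bound : (2 ^ n <= e * n.+1)%N.
Proof.
apply: unbounded_power_bound => -[a0 [b0 [al0_lim be0_lim]]].
exact: bounded_power_absurd al0_lim be0_lim.
Qed.

End Degeneration.

(** * Complex coefficients *)

Section Complex.
Variable R : realType.

Lemma normc_le_ReIm (z : R[i]) :
  `|z| <= `|complex.Re z|%:C + `|complex.Im z|%:C.
Proof.
rewrite {1}(complexE z); apply: le_trans (ler_normD _ _) _.
have normRC (r : R) : `|r%:C| = `|r|%:C by rewrite normc_def /= expr0n addr0 sqrtr_sqr.
have normi : `|'i : R[i]| = 1 by rewrite normc_def /= expr0n expr1n add0r sqrtr1.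
by rewrite normrM normi mul1r !normRC.
Qed.

Lemma normc_ge_Im (z : R[i]) : `|complex.Im z|%:C <= `|z|.
Proof.
by rewrite normc_def lecR -sqrtr_sqr ler_wsqrtr // lerDr sqr_ge0.
Qed.

(** Compactness of [-M, M] gives a cluster point, and an ultrafilter converges to its cluster
    points. *)
Lemma ultra_bounded_tends (T : Type) (U : set_system T) (f : T -> R) (M : R) :
  UltraFilter U -> (\forall x \near U, `|f x| <= M) ->
  exists l, forall eps, 0 < eps -> \forall x \near U, `|l - f x| < eps.
Proof.
move=> UU fM.
have FM : (f x @[x --> U])%classic `[- M, M]%classic.
  by apply: filterS fM => x; rewrite ler_norml /= in_itv.
have [l [_ cl]] := @segment_compact R (- M) M _ _ FM.
exists l => eps eps0; pose B := [set x | `|l - f x| < eps]%classic.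
case: (in_ultra_setVsetC B UU) => // nB.
have Bl : nbhs l [set y | `|l - y| < eps]%classic by apply: nbhsx_ballx.
have nBf : (f x @[x --> U])%classic [set y | ~ (`|l - y| < eps)]%classic by [].
by have [y [ny yl]] := cl _ _ nBf Bl.
Qed.

(** If [g] is bounded on a set of [U], its real and imaginary parts converge; otherwise, for each M,
    the ultrafilter contains the set where |g| > M. *)
Lemma dichotomous_ultra (T : Type) (U : set_system T) :
  UltraFilter U -> dichotomous R[i] U.
Proof.
move=> UU g.
have [[M gM]|unb] := pselect (exists M : R, U [set x | `|g x| <= M%:C]%classic).
  left.
  have ReM : \forall x \near U, `|complex.Re (g x)| <= M.
    by apply: filterS gM => x /= gx; rewrite -lecR (le_trans (normc_ge_Re _)).
  have ImM : \forall x \near U, `|complex.Im (g x)| <= M.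
    by apply: filterS gM => x /= gx; rewrite -lecR (le_trans (normc_ge_Im _)).
  have [a Ha] := ultra_bounded_tends UU ReM.
  have [b Hb] := ultra_bounded_tends UU ImM.
  exists (a +i* b); split; apply/cvgrPdist_lt => -[e1 e2].
  rewrite ltcE /= => /andP[/eqP -> e0]; have e20 : 0 < e1 / 2 by rewrite divr_gt0.
  apply: filterS2 (Ha _ e20) (Hb _ e20) => x Hax Hbx.
  apply: le_lt_trans (normc_le_ReIm _) _.
  by rewrite -rmorphD ltcR /=; case: (g x) Hax Hbx => u v /= ? ?; lra.
have big (M : R) : \forall x \near U, M%:C < `|g x|.
  case: (in_ultra_setVsetC [set x | `|g x| <= M%:C]%classic UU) => [gM|].
    by case: unb; exists M.
  apply: filterS => x /= /negP; rewrite real_ltNge ?normr_real //.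
  by rewrite complex_real.
right; split.
  by apply: filterS (big 0) => x; rewrite normr_gt0.
split; apply/cvgrPdist_lt => -[e1 e2].
rewrite ltcE /= => /andP[/eqP -> e0].
apply: filterS (big e1^-1) => x gx; rewrite sub0r normrN normfV.
have gx0 : 0 < `|g x| by apply: lt_trans gx; rewrite ltcR invr_gt0.
rewrite -[_ +i* 0]invrK ltf_pV2 ?posrE //; last by rewrite invr_gt0 ltcR.
by rewrite (_ : (e1 +i* 0)^-1 = (e1^-1)%:C) // [RHS]rmorphV ?unitfE ?gt_eqF.
Qed.

(** The preimages of the neighbourhoods of [f] are nonempty, so they generate a proper filter, which
    extends to an ultrafilter; reading off a coefficient is continuous. *)
Lemma closure_ultra n N (f : {mpoly R[i][n]}) (g : {mpoly R[i][N]}) :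
  aff_degeneration f g ->
  exists2 U : set_system ('M[R[i]]_(N, n) * 'cV[R[i]]_N), UltraFilter U &
    forall m, tends U (fun Ab => (aff_subst g Ab.1 Ab.2)@_m) f@_m.
Proof.
move=> fg; pose co (Ab : 'M[R[i]]_(N, n) * 'cV[R[i]]_N) :=
  coeffs (aff_subst g Ab.1 Ab.2).
pose F := filter_from (nbhs (coeffs f)) (fun B => co @^-1` B)%classic.
have FF : ProperFilter F.
  apply: filter_from_proper; first apply: filter_from_filter.
  - by exists setT; apply: filterT.
  - by move=> A B fA fB; exists (A `&` B)%classic => //; apply: filterI.
  by move=> B /fg [_ [[Ab _ <-] BAb]]; exists Ab.
have [U [UU FU]] := ultraFilterLemma FF.
exists U => // m; split.
move=> V Vm; apply: FU.
exists [set h | V (h m)]%classic => //.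
exact: (@proj_continuous _ _ m (coeffs f) V Vm).
Qed.

End Complex.

(** * Affine substitutions: restriction to lines and degree bounds *)

Section Substitution.
Variables (K : numFieldType) (n e : nat).

Definition aff_form (N : nat) (A : 'M[K]_(N, n)) (b : 'cV[K]_N) (i : 'I_N) :
    {mpoly K[n]} :=
  \sum_(j < n) A i j *: 'X_j + (b i ord0)%:MP.

Lemma aff_subst_power (A : 'M[K]_(e + 1, n)) (b : 'cV[K]_(e + 1)) :
  aff_subst (prod_plus_powers K 1 e) A b =
  \prod_(i < e) aff_form A b (lshift 1 i) + aff_form A b (rshift e ord0) ^+ e.
Proof.
rewrite /aff_subst /prod_plus_powers rmorphD rmorph_prod /= big_ord1 rmorphXn /=.
by congr (_ + _ ^+ _); [apply: eq_bigr => i _|];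
  rewrite comp_mpolyXU -tnth_nth tnth_mktuple.
Qed.

Lemma on_line_aff_form N (A : 'M[K]_(N, n)) (b : 'cV[K]_N) i p q :
  on_line p q (aff_form A b i) = aff_line (A i) (b i ord0) p q.
Proof.
rewrite /on_line /aff_form rmorphD /= mmapC rmorph_sum /aff_line /dot /=.
rewrite polyCD addrAC; congr (_ + _).
rewrite (raddf_sum (@polyC K)) scaler_suml -big_split /=; apply: eq_bigr => j _ /=.
by rewrite mmapZ mmapX mmap1U mulrDr -polyCM mul_polyC scalerA.
Qed.

Lemma msize_aff_form_le N (A : 'M[K]_(N, n)) (b : 'cV[K]_N) i :
  (msize (aff_form A b i) <= 2)%N.
Proof.
apply: leq_trans (msizeD_le _ _) _; rewrite geq_max; apply/andP; split.
  apply: leq_trans (msize_sum _ _ _) _; apply/bigmax_leqP => j _.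
  by apply: leq_trans (msizeZ_le _ _) _; rewrite msizeX mdeg1.
by rewrite msizeC; apply: leq_trans (leq_b1 _) _.
Qed.

(** Each factor costs 2, plus 1 from [msizeM_le]. The bound is crude: what matters is that it is
    uniform in the forms. *)
Lemma msize_prod_le (I : Type) (r : seq I) (G : I -> {mpoly K[n]}) :
  (forall i, msize (G i) <= 2)%N ->
  (msize (\prod_(i <- r) G i) <= 3 * size r + 1)%N.
Proof.
move=> G2; elim: r => [|i r IHr]; first by rewrite big_nil msize1.
rewrite big_cons; apply: leq_trans (msizeM_le _ _) _.
have -> : (3 * size (i :: r) + 1 = (2 + (3 * size r + 1)).+1)%N.
  by rewrite /= mulnS addnA.
by rewrite ltnS; apply: leq_add.
Qed.

Lemma msize_aff_subst_power (A : 'M[K]_(e + 1, n)) (b : 'cV[K]_(e + 1)) :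
  (msize (aff_subst (prod_plus_powers K 1 e) A b) <= 3 * e + 1)%N.
Proof.
rewrite aff_subst_power; apply: leq_trans (msizeD_le _ _) _.
rewrite -[X in _ ^+ X]card_ord -prodr_const geq_max.
apply/andP; split; apply: leq_trans (msize_prod_le _ _) _;
  by [move=> i; apply: msize_aff_form_le | rewrite /index_enum -enumT size_enum_ord].
Qed.

End Substitution.

Lemma on_line_target (K : numFieldType) d (p q : 'I_(d + 2) -> K) :
  on_line p q (prod_plus_powers K 2 d) = target_line p q.
Proof.
rewrite /on_line /prod_plus_powers rmorphD rmorph_prod rmorph_sum /=.
congr (_ + _); apply: eq_bigr => i _; rewrite ?rmorphXn /=;
  by rewrite mmapX mmap1U.
Qed.

(** * The exponential lower bound *)

Lemma degeneration_exponential (R : realType) (n e : nat) : (0 < n)%N ->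
  aff_degeneration (prod_plus_powers R[i] 2 n.+1) (prod_plus_powers R[i] 1 e) ->
  (2 ^ n <= e * n.+1)%N.
Proof.
move=> n0 /closure_ultra[U UU cU].
pose al (i : 'I_e) (x : 'M[R[i]]_(e + 1, n.+1 + 2) * 'cV[R[i]]_(e + 1)) :=
  x.1 (lshift 1 i).
pose be (i : 'I_e) (x : 'M[R[i]]_(e + 1, n.+1 + 2) * 'cV[R[i]]_(e + 1)) :=
  x.2 (lshift 1 i) ord0.
pose al0 (x : 'M[R[i]]_(e + 1, n.+1 + 2) * 'cV[R[i]]_(e + 1)) :=
  x.1 (rshift e ord0).
pose be0 (x : 'M[R[i]]_(e + 1, n.+1 + 2) * 'cV[R[i]]_(e + 1)) :=
  x.2 (rshift e ord0) ord0.
have lim_line p q q0 : (forall i, tends U (fun x => q x i) (q0 i)) ->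
    ptends U (fun x => \prod_(i < e) aff_line (al i x) (be i x) p (q x) +
                       aff_line (al0 x) (be0 x) p (q x) ^+ e)
             (target_line p q0).
  move=> qq0 j; rewrite -on_line_target.
  pose D := maxn (3 * e + 1) (msize (prod_plus_powers R[i] 2 n.+1)).
  have := @ptends_on_line _ _ U _ _ D (fun x => aff_subst (prod_plus_powers R[i] 1 e) x.1 x.2)
    _ p q0 q _ (leq_maxr _ _) cU qq0 j.
  move=> /(_ _) lim; apply: tends_eq (lim _) => [x|x].
    rewrite aff_subst_power /on_line rmorphD rmorph_prod rmorphXn /=.
    rewrite -/(on_line _ _ _) on_line_aff_form; congr (_`_j).
    congr (polyseq (_ + _)); apply: eq_bigr => i _.
    by rewrite -/(on_line _ _ _) on_line_aff_form.
  by apply: leq_trans (msize_aff_subst_power _ _) (leq_maxl _ _).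
have [e0|e_gt0] := posnP e; last first.
  exact: (degeneration_bound n0 e_gt0 lim_line (dichotomous_ultra UU)).
(* For e = 0 the family is constantly 1 + 1, while the target vanishes at the origin. *)
subst e; pose proof (eval_limit lim_line (fun=> 0)) as lim.
have two : tends U (fun=> 1 + 1) (1 + 1 : R[i]) by exact: tends_cst.
have /eqP : 1 + 1 = 0 :> R[i].
  apply: tends_unique two _; move: lim.
  rewrite [X in tends _ _ (X + _)](bigD1 ord0) //= mul0r add0r.
  rewrite [X in tends _ _ X]big1 => [|j _]; last by rewrite expr0n.
  by apply: tends_eq => x; rewrite big_ord0 expr0.
by rewrite -(natrD _ 1 1) pnatr_eq0.
Qed.

(** Applied with k + 5 = [d./2], hence the threshold d >= 10; strictness takes care of odd d. *)
Lemma double_le_exp (k : nat) : (2 * (k + 5) < 2 ^ (k + 4))%N.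
Proof. by elim: k => // k IHk; rewrite !addSn expnS; lia. Qed.

Theorem mainTheorem8 (R : realType) :
  exists2 c : R, 0 < c &
  exists d0 : nat, forall d e : nat, (d0 <= d)%N ->
    aff_degeneration (prod_plus_powers R[i] 2 d) (prod_plus_powers R[i] 1 e) ->
    2 `^ (c * d%:R) <= e%:R.
Proof.
exists 2^-1; first by rewrite invr_gt0.
exists 10%N => -[//|n] e n9 /(degeneration_exponential (leq_trans (isT : (0 < 9)%N) n9)) bound.
(* With h = [d./2], the factor d of the bound is at most 2^(h-1), and 2^(d-1) / 2^(h-1) has exponent
   d - h = [uphalf d], at least d/2. *)
have le_e : (2 ^ (uphalf n.+1) <= e)%N.
  have bound2 : (n.+1 <= 2 ^ (n.+1./2).-1)%N.
    have := double_le_exp (n.+1./2 - 5).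
    have -> : (n.+1./2 - 5 + 5 = n.+1./2)%N by lia.
    have -> : (n.+1./2 - 5 + 4 = (n.+1./2).-1)%N by lia.
    by apply: leq_trans; lia.
  have halves : (uphalf n.+1 + (n.+1./2).-1 = n)%N by lia.
  rewrite -(leq_pmul2r (ltn0Sn n)); apply: leq_trans bound.
  by rewrite -[X in (_ <= 2 ^ X)%N]halves expnD leq_mul2l bound2 orbT.
apply: (@le_trans _ _ (2 `^ (uphalf n.+1)%:R)).
  rewrite ler_powR ?ler1n //.
  rewrite mulrC ler_pdivrMr // -natrM ler_nat; lia.
by rewrite powR_mulrn // -natrX ler_nat.
Qed.
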